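(* Let $(g_{ij})_{1\le i<j\le n}$ be i.i.d. standard Gaussian random variables, and let $$G_n:=\max_{\sigma\in\{-1,1\}^n}\frac{1}{\sqrt n}\sum_{1\le i<j\le n}g_{ij}\sigma_i\sigma_j$$ be the ground state energy of the Sherrington--Kirkpatrick model. Then $G_n$ has fluctuations of order at least $1$.
   Context: Fluctuations: for a sequence of random variables $\{X_n\}$ and a sequence of positive real numbers $\{\delta_n\}$, we say that $X_n$ has fluctuations of order at least $\delta_n$ if there are positive constants $c_1,c_2$ such that for all large $n$, and for all $-\infty<a\le b<\infty$ with $b-a\le c_1\delta_n$, $\mathbb{P}(a\le X_n\le b)\le 1-c_2$. ''Order at least $1$'' means $\delta_n=1$ for all $n$. *)

(* Defs.v *)
From HB Require Import structures.
From mathcomp Require Import all_boot all_order all_algebra.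
From mathcomp Require Import all_classical all_reals all_analysis.
From mathcomp Require Import measurable_realfun.
Set Implicit Arguments.
Unset Strict Implicit.
Unset Printing Implicit Defensive.
Import Order.TTheory GRing.Theory Num.Theory.
Import numFieldNormedType.Exports.
Local Open Scope classical_set_scope.
Local Open Scope ring_scope.

(* The random variables X n need not live on a common probability space:
   only the law of each X n matters. *)
Definition fluctuations_at_least (R : realType) (d : nat -> measure_display)
    (T : forall n, measurableType (d n)) (P : forall n, probability (T n) R)
    (X : forall n, {RV (P n) >-> R}) (delta : nat -> R) : Prop :=
  exists c1 c2 : R, [/\ 0 < c1, 0 < c2 &
    \forall n \near \oo, forall a b : R, a <= b -> b - a <= c1 * delta n ->
      (P n [set w | (a <= X n w <= b)%R] <= (1 - c2)%:E)%E].

Definition mutually_independent (R : realType) (d : measure_display)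
    (T : measurableType d) (P : probability T R) (I : finType)
    (X : I -> {RV P >-> R}) : Prop :=
  forall (J : {set I}) (B : I -> set R), (forall i, measurable (B i)) ->
    P (\bigcap_(i in [set` J]) (X i @^-1` B i)) =
    (\prod_(i in J) P (X i @^-1` B i))%E.

Definition standard_gaussian (R : realType) (d : measure_display)
    (T : measurableType d) (P : probability T R) (X : {RV P >-> R}) : Prop :=
  forall A : set R, measurable A -> distribution P X A = normal_prob 0 1 A.

Definition iid_standard_gaussian (R : realType) (d : measure_display)
    (T : measurableType d) (P : probability T R) (I : finType)
    (X : I -> {RV P >-> R}) : Prop :=
  mutually_independent X /\ forall i, standard_gaussian (X i).

Definition edge (n : nat) : finType := {e : 'I_n * 'I_n | (e.1 < e.2)%N}.

(* The elements of {-1, 1}^n are encoded by boolean vectors, [false] standing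
   for the spin 1 and [true] for the spin -1. *)
Definition spin (R : realType) (n : nat) (s : {ffun 'I_n -> bool}) (i : 'I_n)
  : R := (-1) ^+ s i.

Definition sk_energy (R : realType) (n : nat) (g : edge n -> R)
    (s : {ffun 'I_n -> bool}) : R :=
  (Num.sqrt n%:R)^-1 *
  \sum_(e : edge n) g e * spin R s (val e).1 * spin R s (val e).2.

(* The default value of the iterated maximum is itself one of the energies, so
   this is the maximum over all configurations. *)
Definition sk_max (R : realType) (n : nat) (g : edge n -> R) : R :=
  \big[Num.max/sk_energy g [ffun=> false]]_(s : {ffun 'I_n -> bool})
    sk_energy g s.

Definition ground_state (R : realType) (n : nat) (d : measure_display)
    (T : measurableType d) (P : probability T R)
    (g : edge n -> {RV P >-> R}) (w : T) : R :=
  sk_max (fun e => g e w).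

Section ground_state_measurable.
Context (R : realType) (n : nat) (d : measure_display) (T : measurableType d)
  (P : probability T R) (g : edge n -> {RV P >-> R}).

Let measurable_energy (s : {ffun 'I_n -> bool}) :
  measurable_fun setT (fun w => sk_energy (fun e => g e w) s).
Proof.
apply: measurable_funM => //; apply: measurable_sum => e.
by do 2 apply: measurable_funM => //.
Qed.

Let measurable_ground_state : measurable_fun setT (ground_state g).
Proof.
rewrite /ground_state /sk_max.
elim: (index_enum _) => [|s r IH].
  by under eq_fun do rewrite big_nil; exact: measurable_energy.
under eq_fun do rewrite big_cons.
exact: measurable_maxr.
Qed.

HB.instance Definition _ :=
  isMeasurableFun.Build d _ T R (ground_state g) measurable_ground_state.

End ground_state_measurable.

(* Main.v *)
Require Import Defs.
From HB Require Import structures.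
From mathcomp Require Import all_boot all_order all_algebra.
From mathcomp Require Import all_classical all_reals all_analysis.
From mathcomp Require Import measurable_realfun.
From mathcomp Require Import ring lra.

(** Scaling every coupling by a constant [s] scales the ground state by [s].
    Take [s = (1 + 1/n)^(-1/2)]. There are about [n^2/2] couplings and [s]
    differs from 1 by about [1/(2n)], so the laws of the coupling vectors [g]
    and [s g] stay close: the density of the second law with respect to the
    first has a second moment bounded uniformly in [n] ([gaussian_tilt],
    [gaussian_tilt_sqr]). By Cauchy-Schwarz, an event that is likely for [g] is
    then also likely for [s g]. On the other hand the ground state [G] is at
    least [n/32] with probability at least 1/8 ([sk_max_lower_bound]), and then
    [G] and [s G] differ by at least [(1 - s) n/32 >= 1/128]. So an interval of
    length at most 1/256 misses [G] or [s G] with probability at least 1/8;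
    since missing [s G] can only be likely if missing [G] is not too unlikely,
    the interval misses [G] with a probability bounded away from zero
    ([ground_state_spread]).

    The lower bound on [G] is the second moment method in the high temperature
    phase. At inverse temperature 1/4 the partition function [Z] has mean
    [2^n exp ((n - 1)/64)] and satisfies [E Z^2 <= 2 (E Z)^2], because the
    overlap of two independent uniform configurations has a bounded exponential
    square moment ([rademacher_sqr_exp_moment]). By the Paley-Zygmund inequality
    [Z >= E Z / 2] with probability at least 1/8, and [Z <= 2^n exp (G/4)] turns
    this into a bound on [G].

    Both halves need only expectations of products of functions of the
    individual couplings, hence [expectation_prod_independent]. *)

Set Implicit Arguments.
Unset Strict Implicit.
Unset Printing Implicit Defensive.
Import Order.TTheory GRing.Theory Num.Theory.
Import numFieldNormedType.Exports.
Local Open Scope classical_set_scope.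
Local Open Scope ring_scope.

(** * Images of weighted measures *)

(** The image under [X] of the measure with density [Y] with respect to [mu].
    Equality of two such measures on sets is the form in which independence
    and changes of density are used below; their integrals then agree on all
    nonnegative functions. *)
Definition weighted_image (R : realType) (d d' : measure_display)
    (T : measurableType d) (T' : measurableType d')
    (mu : {measure set T -> \bar R}) (X : T -> T') (Y : T -> R)
    (mX : measurable_fun setT X) (mY : measurable_fun setT Y)
    (Y0 : forall t, 0 <= Y t) (B : set T') : \bar R :=
  (\int[mu]_(t in X @^-1` B) (Y t)%:E)%E.

Section weighted_image.
Context (R : realType) (d d' : measure_display) (T : measurableType d)
  (T' : measurableType d') (mu : {measure set T -> \bar R})
  (X : T -> T') (Y : T -> R) (mX : measurable_fun setT X)
  (mY : measurable_fun setT Y) (Y0 : forall t, 0 <= Y t).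

Local Notation nu := (weighted_image mu mX mY Y0).

Let mEY : measurable_fun setT (fun t => (Y t)%:E).
Proof. exact/measurable_EFinP. Qed.

Let mpreX B : measurable B -> measurable (X @^-1` B).
Proof. by move=> mB; rewrite -[_ @^-1` _]setTI; exact: mX. Qed.

Let weighted_image0 : nu set0 = 0%E.
Proof. by rewrite /weighted_image preimage_set0 integral_set0. Qed.

Let weighted_image_ge0 B : (0 <= nu B)%E.
Proof. by apply: integral_ge0 => t _; rewrite lee_fin. Qed.

Let weighted_image_sigma_additive : semi_sigma_additive nu.
Proof.
move=> F mF tF mUF; rewrite /weighted_image preimage_bigcup.
apply: semi_sigma_additive_nng_induced => //.
- by move=> n; exact: mpreX.
- apply/trivIsetP => i j _ _ ij; rewrite -preimage_setI.
  by move/trivIsetP : tF => /(_ _ _ _ _ ij) ->//; rewrite preimage_set0.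
- by rewrite -preimage_bigcup; exact: mpreX.
Qed.

HB.instance Definition _ := isMeasure.Build _ _ _ nu
  weighted_image0 weighted_image_ge0 weighted_image_sigma_additive.

Import HBNNSimple.

(** Clear for indicators, hence for simple functions; monotone convergence on
    both sides along one increasing sequence of simple functions. *)
Lemma ge0_integral_weighted_image (f : T' -> R) :
    measurable_fun setT f -> (forall y, 0 <= f y) ->
  (\int[nu]_y (f y)%:E = \int[mu]_t (f (X t) * Y t)%:E)%E.
Proof.
move=> mf f0.
have mEf : measurable_fun setT (fun y => (f y)%:E) by exact/measurable_EFinP.
have Ef0 y : setT y -> (0 <= (f y)%:E)%E by rewrite lee_fin.
pose h := nnsfun_approx measurableT mEf.
have nd_h y : {homo (h ^~ y) : m n / (m <= n)%N >-> m <= n}.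
  by move=> m n mn; exact/lefP/nd_nnsfun_approx.
have h_cvg y : ((h n y)%:E @[n --> \oo] --> (f y)%:E)%E.
  exact: (cvg_nnsfun_approx measurableT mEf Ef0).
have mhX n : measurable_fun setT (fun t => h n (X t) * Y t).
  by apply: measurable_funM => //; exact: measurableT_comp.
have mind n y :
    measurable_fun setT (fun t => \1_(h n @^-1` [set y]) (X t) : R).
  by apply: (@measurableT_comp _ _ _ _ _ _ (\1_(h n @^-1` [set y]) : T' -> R)).
have hE n : (\int[nu]_y (h n y)%:E = \int[mu]_t (h n (X t) * Y t)%:E)%E.
  under [LHS]eq_integral do rewrite fimfunE -fsumEFin//.
  rewrite ge0_integral_fsum//; last 2 first.
  - by move=> y; exact/measurable_EFinP/measurableT_comp.
  - by move=> y z _; rewrite EFinM nnfun_muleindic_ge0.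
  transitivity (\sum_(y \in range (h n))
      \int[mu]_t (y * \1_(h n @^-1` [set y]) (X t) * Y t)%:E)%E.
    apply: eq_fsbigr => y _; rewrite integralZl_indic_nnsfun//.
    rewrite integral_indic// setIT /= /weighted_image.
    have [y0|y0] := ltP y 0.
      rewrite preimage_nnfun0// preimage_set0 integral_set0 mule0.
      by rewrite integral0_eq// => t _; rewrite indic0 /= mulr0 mul0r.
    under [RHS]eq_integral do rewrite -mulrA EFinM.
    rewrite ge0_integralZl//; last 2 first.
    - exact/measurable_EFinP/measurable_funM.
    - by move=> t _; rewrite lee_fin mulr_ge0.
    congr (_ * _)%E; rewrite integral_mkcond; apply: eq_integral => t _.
    rewrite /patch indicE; case: ifPn => /=.
      by rewrite inE => /= ht; rewrite mem_set//= mul1r.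
    by rewrite notin_setE => /= ht; rewrite memNset//= mul0r.
  rewrite -ge0_integral_fsum//; last 2 first.
  - move=> y; apply/measurable_EFinP/measurable_funM => //.
    exact: measurable_funM.
  - move=> y t _; rewrite EFinM mule_ge0 ?lee_fin//.
    by rewrite -lee_fin EFinM nnfun_muleindic_ge0.
  apply: eq_integral => t _; rewrite fsumEFin//; congr (_%:E).
  by rewrite -mulr_fsuml// -fimfunE.
have lhs : (\int[nu]_y (h n y)%:E @[n --> \oo] --> \int[nu]_y (f y)%:E)%E.
  rewrite (_ : (\int[nu]_y (f y)%:E =
      \int[nu]_y (limn (fun n => (h n y)%:E)))%E); last first.
    by apply: eq_integral => y _; apply/esym/cvg_lim.
  apply: cvg_monotone_convergence => //.
  - by move=> n; exact/measurable_EFinP.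
  - by move=> n y _; rewrite lee_fin.
  - by move=> y _ m n mn; rewrite lee_fin nd_h.
have rhs : (\int[mu]_t (h n (X t) * Y t)%:E @[n --> \oo] -->
            \int[mu]_t (f (X t) * Y t)%:E)%E.
  rewrite (_ : (\int[mu]_t (f (X t) * Y t)%:E =
      \int[mu]_t (limn (fun n => (h n (X t) * Y t)%:E)))%E); last first.
    apply: eq_integral => t _; apply/esym/cvg_lim => //.
    by under eq_fun do rewrite EFinM; rewrite EFinM; apply: cvgeZr.
  apply: cvg_monotone_convergence => //.
  - by move=> n; exact/measurable_EFinP.
  - by move=> n t _; rewrite lee_fin mulr_ge0.
  - by move=> t _ m n mn; rewrite lee_fin ler_wpM2r// nd_h.
rewrite -(cvg_lim _ lhs)// -(cvg_lim _ rhs)//.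
by congr (lim _); under eq_fun do rewrite hE.
Qed.

End weighted_image.

(** * Expectations of products of independent variables *)

Section independence.
Context (R : realType) (d : measure_display) (T : measurableType d)
  (P : probability T R) (I : finType) (X : I -> {RV P >-> R}).
Hypothesis indepX : mutually_independent X.

Lemma expectation_prod_indic (B : I -> set R) :
    (forall i, measurable (B i)) ->
  (\int[P]_w (\prod_i (\1_(B i) (X i w) : R))%:E =
   \prod_i P (X i @^-1` B i))%E.
Proof.
move=> mB; have := indepX [set: I]%SET mB.
under [X in _ = X -> _]eq_bigl do rewrite finset.in_setT.
move=> <-.
rewrite -[X in _ = P X]setIT -integral_indic //; last first.
  apply: fin_bigcap_measurable => [|i _]; first exact: finite_finset.
  by rewrite -[_ @^-1` _]setTI; exact: measurable_funP.
apply: eq_integral => w _; congr (_%:E).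
rewrite indicE; case: (boolP (w \in _)).
  rewrite inE => wB; rewrite big1// => i _; rewrite indicE mem_set//.
  by apply: wB => /=; rewrite finset.in_setT.
rewrite notin_setE => wB.
have [i wi] : exists i, ~ B i (X i w).
  by apply/existsNP => wB'; apply: wB => i _; exact: wB'.
by rewrite (bigD1 i)//= indicE memNset// mul0r.
Qed.

(** Independence is the case where all factors are indicators. The factors are
    made general one at a time: with the others fixed, both sides are the value
    of a measure on a set when the factor at [i0] is an indicator, so these
    measures are equal and have the same integrals. *)
Lemma expectation_prod_independent (F : I -> R -> R) (m : I -> R) :
    (forall i, measurable_fun setT (F i)) -> (forall i x, 0 <= F i x) ->
    (forall i, \int[P]_w (F i (X i w))%:E = (m i)%:E)%E ->
  (\int[P]_w (\prod_i F i (X i w))%:E = (\prod_i m i)%:E)%E.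
Proof.
(* The factors at indices outside [s] are still indicators. *)
have [s ss] : exists s : seq I, forall i, i \notin s -> False.
  by exists (enum I) => i; rewrite mem_enum.
move=> mF F0 mE.
have : forall i, i \notin s -> exists2 B, measurable B & F i = \1_B.
  by move=> i /ss.
elim: s {ss} F m mF F0 mE => [|i0 s IH] F m mF F0 mE Find.
  have /choice[B hB] : forall i, exists B, measurable B /\ F i = \1_B.
    by move=> i; have [//|B mB FB] := Find i; exists B.
  have mB i : measurable (B i) by case: (hB i).
  have FB i : F i = \1_(B i) by case: (hB i).
  under eq_integral do under eq_bigr do rewrite FB.
  rewrite expectation_prod_indic// -prodEFin; apply: eq_bigr => i _.
  rewrite -mE FB -[X in P X = _]setIT -integral_indic//.
  by rewrite -[_ @^-1` _]setTI; exact: measurable_funP.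
have mX i : measurable_fun setT (X i) by [].
have mFX i : measurable_fun setT (fun w => F i (X i w)).
  exact: measurableT_comp.
have m0 i : 0 <= m i.
  by rewrite -lee_fin -mE; apply: integral_ge0 => w _; rewrite lee_fin.
pose Y w := \prod_(i | i != i0) F i (X i w).
have mY : measurable_fun setT Y.
  rewrite /Y; under eq_fun do rewrite -big_filter; exact: measurable_prod.
have Y0 w : 0 <= Y w by apply: prodr_ge0.
pose c := \prod_(i | i != i0) m i.
have c0 : 0 <= c by apply: prodr_ge0.
pose Z (_ : T) := c.
have mZ : measurable_fun setT Z by exact: measurable_cst.
have Z0 w : 0 <= Z w by [].
transitivity (\int[weighted_image P (mX i0) mY Y0]_x (F i0 x)%:E)%E.
  rewrite ge0_integral_weighted_image//; apply: eq_integral => w _.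
  by rewrite (bigD1 i0).
transitivity (\int[weighted_image P (mX i0) mZ Z0]_x (F i0 x)%:E)%E; last first.
  rewrite ge0_integral_weighted_image// /Z.
  under eq_integral do rewrite EFinM.
  rewrite ge0_integralZr//.
  - by rewrite mE -EFinM (bigD1 i0).
  - exact/measurable_EFinP.
  - by move=> w _; rewrite lee_fin.
apply: eq_measure_integral => B mB _.
rewrite /= /weighted_image /Z integral_cst//; last first.
  by rewrite -[_ @^-1` _]setTI; exact: measurable_funP.
pose F' i := if i == i0 then (\1_B : R -> R) else F i.
pose m' i := if i == i0 then fine (P (X i0 @^-1` B)) else m i.
have PE : P (X i0 @^-1` B) = (fine (P (X i0 @^-1` B)))%:E.
  rewrite fineK// fin_num_measure//.
  by rewrite -[_ @^-1` _]setTI; exact: measurable_funP.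
have := IH F' m'.
rewrite [X in (_ -> _ -> _ -> _ -> _ = X%:E) -> _](bigD1 i0)//=.
rewrite /m' eqxx (eq_bigr m); last by move=> i /negbTE ->.
rewrite -/c mulrC EFinM -PE => <-.
- rewrite integral_mkcond; apply: eq_integral => w _.
  rewrite (bigD1 i0)//= /F' eqxx (eq_bigr (fun i => F i (X i w))); last first.
    by move=> i /negbTE ->.
  rewrite /patch indicE; case: ifPn => /=.
    by rewrite inE => /= ht; rewrite mem_set//= mul1r.
  by rewrite notin_setE => /= ht; rewrite memNset//= mul0r.
- by move=> i; rewrite /F'; case: ifP.
- by move=> i x; rewrite /F'; case: ifP.
- move=> i; rewrite /F'; case: ifP => // /eqP ->.
  rewrite -PE -[X in _ = P X]setIT -integral_indic//.
  by rewrite -[_ @^-1` _]setTI; exact: measurable_funP.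
- move=> i ins; rewrite /F'; case: (altP (i =P i0)) => [_|ii0].
    by exists B.
  by apply: Find; rewrite inE negb_or ii0.
Qed.

End independence.

(** * Tilting and scaling the Gaussian density *)

Section gaussian_density.
Context {R : realType}.
Local Notation mu := (@lebesgue_measure R).
Local Notation phi := (@normal_pdf R 0 1).

Lemma normal_pdf_scale (a x : R) : 0 < a ->
  normal_pdf 0 a x = a^-1 * phi (x / a).
Proof.
move=> a0; rewrite !normal_pdfE ?gt_eqF// mulrA; congr (_ * _); last first.
  rewrite /normal_fun !subr0 expr1n exprMn exprVn; congr expR.
  have : a ^+ 2 != 0 by rewrite sqrf_eq0 gt_eqF.
  by move=> ?; field; rewrite gt_eqF.
rewrite /normal_peak -[a ^+ 2 * pi *+ 2]mulrnAr -[1 ^+ 2 * pi *+ 2]mulrnAr.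
by rewrite expr1n mul1r sqrtrM ?sqr_ge0// sqrtr_sqr gtr0_norm// invfM.
Qed.

(** Completing the exponent: the tilt only changes the variance, from [1] to
    [1 / (1 + c)]. *)
Lemma normal_pdf_quadratic_tilt (c x : R) : -1 < c ->
  expR (- (c * x ^+ 2 / 2)) * phi x =
  (Num.sqrt (1 + c))^-1 * normal_pdf 0 (Num.sqrt (1 + c))^-1 x.
Proof.
move=> c1; have c0 : 0 < 1 + c by lra.
have s0 : 0 < Num.sqrt (1 + c) by rewrite sqrtr_gt0.
rewrite [normal_pdf 0 _^-1 x]normal_pdf_scale ?invr_gt0// invrK.
rewrite [RHS]mulrA mulVf ?gt_eqF// mul1r.
rewrite !normal_pdfE ?gt_eqF// mulrCA; congr (_ * _).
rewrite /normal_fun !subr0 expr1n -expRD exprMn sqr_sqrtr ?ltW//.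
by congr expR; field.
Qed.

(** Completing the square: the tilt only moves the mean, from [0] to [l]. *)
Lemma normal_pdf_exponential_tilt (l x : R) :
  expR (l * x) * phi x = expR (l ^+ 2 / 2) * normal_pdf l 1 x.
Proof.
rewrite !normal_pdfE ?gt_eqF// mulrCA [RHS]mulrCA; congr (_ * _).
by rewrite /normal_fun -!expRD; congr expR; field.
Qed.

Lemma measurable_gauss_sqr (c : R) :
  measurable_fun setT (fun x : R => expR (- (c * x ^+ 2 / 2))).
Proof.
apply: measurableT_comp => //; apply: measurableT_comp => //.
by apply: measurable_funM => //; exact: measurable_funM.
Qed.

Lemma integral_exp_normal_pdf (l : R) :
  (\int[mu]_x (expR (l * x) * phi x)%:E = (expR (l ^+ 2 / 2))%:E)%E.
Proof.
under eq_integral do rewrite normal_pdf_exponential_tilt EFinM.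
rewrite ge0_integralZl ?lee_fin ?expR_ge0//.
- by rewrite integral_normal_pdf mule1.
- by apply/measurable_EFinP; exact: measurable_normal_pdf.
- by move=> x _; rewrite lee_fin normal_pdf_ge0.
Qed.

Lemma integral_expsqr_normal_pdf (c : R) : -1 < c ->
  (\int[mu]_x (expR (- (c * x ^+ 2 / 2)) * phi x)%:E =
   ((Num.sqrt (1 + c))^-1)%:E)%E.
Proof.
move=> c1; under eq_integral do rewrite normal_pdf_quadratic_tilt// EFinM.
rewrite ge0_integralZl ?lee_fin ?invr_ge0//.
- by rewrite integral_normal_pdf mule1.
- by apply/measurable_EFinP; exact: measurable_normal_pdf.
- by move=> x _; rewrite lee_fin normal_pdf_ge0.
Qed.

(** Stated as a weighted image so that it serves directly as a linear change of
    variables in an integral. *)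
Lemma lebesgue_measure_scale (a : R) (a0 : 0 < a)
    (ma : measurable_fun setT ( *%R a : measurableTypeR R -> measurableTypeR R))
    (mc : measurable_fun setT (fun _ : measurableTypeR R => a))
    (c0 : forall x : R, 0 <= a)
    (A : set R) : measurable A ->
  mu A = weighted_image mu ma mc c0 A.
Proof.
pose nu : {measure set (measurableTypeR R) -> \bar R} :=
  weighted_image mu ma mc c0.
move: A; apply: (@lebesgue_measure_unique R nu).
move=> _ [[x y] _ <-]; rewrite /nu /= /weighted_image.
rewrite integral_cst//=; last first.
  by rewrite -[X in measurable X]setTI; exact: (ma measurableT).
rewrite (_ : _ @^-1` _ = `]x / a, y / a]%classic); last first.
  apply/seteqP; split => z /=; rewrite !in_itv/=;
  by rewrite ltr_pdivrMr// ler_pdivlMr// ![z * a]mulrC.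
rewrite !lebesgue_measure_itv/= !lte_fin ltr_pM2r ?invr_gt0//.
case: ifP => _; last by rewrite mule0.
by rewrite -!EFinD -EFinM -mulrBl mulrC divfK// gt_eqF.
Qed.

Lemma normal_prob_scale (a : R) (B : set R) : 0 < a -> measurable B ->
  normal_prob 0 1 ( *%R a @^-1` B) = normal_prob 0 a B.
Proof.
move=> a0 mB.
have ma : measurable_fun setT
    ( *%R a : measurableTypeR R -> measurableTypeR R).
  exact: measurable_funM.
have mc : measurable_fun setT (fun _ : measurableTypeR R => a) by [].
have c0 (x : R) : 0 <= a by exact: ltW.
rewrite /normal_prob [RHS]integral_mkcond.
rewrite (eq_measure_integral (weighted_image mu ma mc c0)); last first.
  by move=> A mA _; exact: lebesgue_measure_scale.
under eq_integral do rewrite restrict_EFin.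
rewrite ge0_integral_weighted_image; last 2 first.
- apply/(measurable_restrictT _ _).1 => //.
  by apply: measurable_funTS; exact: measurable_normal_pdf.
- by move=> x; rewrite /patch; case: ifP => // _; exact: normal_pdf_ge0.
rewrite [LHS]integral_mkcond; apply: eq_integral => x _.
rewrite /patch; case: ifPn => [|].
  rewrite inE /= => xB; rewrite mem_set// [normal_pdf 0 a _]normal_pdf_scale//.
  by rewrite [a * x]mulrC mulfK ?gt_eqF// mulrC mulrA divff ?gt_eqF// mul1r.
by rewrite notin_setE /= => xB; rewrite memNset// mul0r.
Qed.

End gaussian_density.

Section gaussian_expectation.
Context (R : realType) (d : measure_display) (T : measurableType d)
  (P : probability T R) (Z : {RV P >-> R}).
Hypothesis gaussZ : standard_gaussian Z.
Local Notation mu := (@lebesgue_measure R).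

Lemma expectation_gaussian (f : R -> R) : measurable_fun setT f ->
    (forall x, 0 <= f x) ->
  (\int[P]_w (f (Z w))%:E = \int[mu]_x (f x * normal_pdf 0 1 x)%:E)%E.
Proof.
move=> mf f0.
rewrite -(ge0_integral_distribution Z (f := EFin \o f))/=; last 2 first.
- exact/measurable_EFinP.
- by move=> x; rewrite lee_fin.
have mi : measurable_fun setT (id : R -> R) by [].
rewrite (eq_measure_integral (weighted_image mu mi
  (measurable_normal_pdf 0 1) (normal_pdf_ge0 0 1))); last first.
  by move=> A mA _; exact: (gaussZ mA).
by rewrite ge0_integral_weighted_image.
Qed.

Lemma expectation_gaussian_exp (l : R) :
  (\int[P]_w (expR (l * Z w))%:E = (expR (l ^+ 2 / 2))%:E)%E.
Proof.
rewrite -integral_exp_normal_pdf.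
rewrite (expectation_gaussian (f := fun x => expR (l * x)))//.
by apply: measurableT_comp => //; exact: measurable_funM.
Qed.

Lemma expectation_gaussian_expsqr (c : R) : -1 < c ->
  (\int[P]_w (expR (- (c * Z w ^+ 2 / 2)))%:E = ((Num.sqrt (1 + c))^-1)%:E)%E.
Proof.
move=> c1; rewrite -integral_expsqr_normal_pdf//.
rewrite (expectation_gaussian (f := fun x => expR (- (c * x ^+ 2 / 2))))//.
exact: measurable_gauss_sqr.
Qed.

(** The law of [Z / sqrt (1 + c)] has density
    [sqrt (1 + c) exp (- c x^2 / 2)] with respect to the law of [Z]. *)
Lemma gaussian_scale_density (c : R) (B : set R) : -1 < c -> measurable B ->
  (\int[P]_w (\1_B (Z w) *
     (Num.sqrt (1 + c) * expR (- (c * Z w ^+ 2 / 2))))%:E =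
   P [set w | B ((Num.sqrt (1 + c))^-1 * Z w)%R])%E.
Proof.
move=> c1 mB; have c0 : 0 < 1 + c by lra.
have s0 : 0 < Num.sqrt (1 + c) by rewrite sqrtr_gt0.
have ma : measurable_fun setT ( *%R (Num.sqrt (1 + c))^-1 : R -> R).
  exact: measurable_funM.
have mpre : measurable ( *%R (Num.sqrt (1 + c))^-1 @^-1` B).
  by rewrite -[X in measurable X]setTI; exact: ma.
have := gaussZ mpre; rewrite normal_prob_scale ?invr_gt0//.
rewrite /distribution /pushforward /= => ->.
rewrite (expectation_gaussian (f := fun x => \1_B x *
  (Num.sqrt (1 + c) * expR (- (c * x ^+ 2 / 2)))))//; last first.
  by do 2 apply: measurable_funM => //; exact: measurable_gauss_sqr.
rewrite /normal_prob [RHS]integral_mkcond; apply: eq_integral => x _.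
transitivity (\1_B x * (Num.sqrt (1 + c) *
    (expR (- (c * x ^+ 2 / 2)) * normal_pdf 0 1 x)))%:E.
  by congr (_%:E); rewrite -[LHS]mulrA; congr (_ * _); rewrite -[LHS]mulrA.
rewrite normal_pdf_quadratic_tilt// [X in _ * X]mulrA divff ?gt_eqF// mul1r.
rewrite /patch indicE; case: ifPn => [|].
  by rewrite inE => /= xB; rewrite mul1r.
by rewrite notin_setE => /= xB; rewrite mul0r.
Qed.

End gaussian_expectation.

(** * Scaling a Gaussian vector as a change of density *)

Section gaussian_tilt.
Context (R : realType) (d : measure_display) (T : measurableType d)
  (P : probability T R) (I : finType) (X : I -> {RV P >-> R}).

(** A pi-system that generates the product sigma-algebra on [I -> R]. *)
Definition rectangles : set (set (I -> R)) :=
  [set D | exists2 B : I -> set R, (forall i, measurable (B i)) &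
    D = [set x | forall i, B i (x i)]].

Local Notation product := (g_sigma_algebraType rectangles).

Lemma measurable_coordinate i :
  measurable_fun setT (fun x : product => (x : I -> R) i).
Proof.
move=> _ B mB; rewrite setTI; apply: sub_sigma_algebra.
exists (fun j => if j == i then B else setT); first by move=> j; case: ifP.
apply/seteqP; split => x /= xB.
  by move=> j; case: (altP (j =P i)) => // ->.
by have := xB i; rewrite eqxx.
Qed.

Lemma measurable_to_product (Y : I -> T -> R) :
  (forall i, measurable_fun setT (Y i)) ->
  measurable_fun setT (fun w => (Y ^~ w) : product).
Proof.
move=> mY; apply: (@measurability _ _ T product setT _ rectangles) => //.
move=> _ [_ [B mB ->] <-]; rewrite setTI.
rewrite (_ : _ @^-1` _ =
    \bigcap_(i in [set` [set: I]%SET]) (Y i @^-1` B i)); last first.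
  apply/seteqP; split => w /= wB i => [_|]; first exact: wB.
  by apply: wB => /=; rewrite finset.in_setT.
apply: fin_bigcap_measurable => [|i _]; first exact: finite_finset.
by rewrite -[_ @^-1` _]setTI; exact: mY.
Qed.

Hypothesis iidX : iid_standard_gaussian X.
Context (c : R) (c1 : -1 < c).

(** Both sides are measures in [D], and on rectangles both factor over the
    coordinates, where the identity is [gaussian_scale_density]. *)
Lemma gaussian_tilt (D : set product) : measurable D ->
  (\int[P]_(w in [set w | D (X ^~ w)])
     (\prod_i (Num.sqrt (1 + c) * expR (- (c * X i w ^+ 2 / 2))))%:E =
   P [set w | D (fun i => (Num.sqrt (1 + c))^-1 * X i w)%R])%E.
Proof.
move=> mD; have [indepX gaussX] := iidX.
set a := (Num.sqrt (1 + c))^-1.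
pose l (x : R) := Num.sqrt (1 + c) * expR (- (c * x ^+ 2 / 2)).
have ml : measurable_fun setT l.
  by apply: measurable_funM => //; exact: measurable_gauss_sqr.
have l0 x : 0 <= l x by rewrite mulr_ge0 ?expR_ge0 ?sqrtr_ge0.
have mX : measurable_fun setT (fun w => (fun i => X i w) : product).
  exact: measurable_to_product.
have maX : measurable_fun setT (fun w => (fun i => a * X i w) : product).
  by apply: measurable_to_product => i; exact: measurable_funM.
have mL : measurable_fun setT (fun w => \prod_i l (X i w)).
  by apply: measurable_prod => i _; exact: measurableT_comp.
have L0 w : 0 <= \prod_i l (X i w) by apply: prodr_ge0.
have m1 : measurable_fun setT (fun w : T => 1 : R) by [].
have one0 (w : T) : 0 <= 1 :> R by [].
have -> : P [set w | D (fun i => a * X i w)] = weighted_image P maX m1 one0 D.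
  rewrite /weighted_image integral_cst ?mul1e//.
  by rewrite -[X in measurable X]setTI; exact: maX.
rewrite -[LHS]/(weighted_image P mX mL L0 D).
pose nu1 : {measure set product -> \bar R} := weighted_image P mX mL L0.
pose nu2 : {measure set product -> \bar R} := weighted_image P maX m1 one0.
(* Uniqueness asks that the first measure be finite, which is visible for the
   law of the scaled vector only. *)
apply/esym.
apply: (@measure_unique _ R product rectangles (fun _ => setT)
  _ _ _ _ nu2 nu1) => //.
- move=> _ _ [A mA ->] [B mB ->]; exists (fun i => A i `&` B i).
    by move=> i; exact: measurableI.
  apply/seteqP; split => x /=; first by move=> [xA xB] i; split.
  by move=> xAB; split => i; have [] := xAB i.
- by move=> _; exists (fun _ => setT) => //; apply/seteqP; split.
- by rewrite bigcup_const//; exists 0%N.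
- move=> _ [B mB ->]; apply/esym.
  have prodE (Y : I -> T -> R) w :
      \prod_i \1_(B i) (Y i w) = \1_[set w | forall i, B i (Y i w)] w :> R.
    rewrite [RHS]indicE; case: (boolP (w \in _)).
      by rewrite inE => /= wB; rewrite big1// => i _; rewrite indicE mem_set.
    rewrite notin_setE /= => /existsNP[i wi].
    by rewrite (bigD1 i)//= indicE memNset// mul0r.
  transitivity (\prod_i P [set w | B i (a * X i w)%R])%E.
    rewrite [LHS]integral_mkcond.
    transitivity (\int[P]_w (\prod_i (\1_(B i) (X i w) * l (X i w)))%:E)%E.
      apply: eq_integral => w _; rewrite big_split/=.
      rewrite (prodE (fun i w => X i w)) indicE.
      rewrite /patch /=; case: ifPn => [|] wB; first by rewrite mul1r.
      by rewrite mul0r.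
    rewrite (expectation_prod_independent indepX
      (F := fun i x => \1_(B i) x * l x)
      (m := fun i => fine (P [set w | B i (a * X i w)%R]))).
    + rewrite -prodEFin; apply: eq_bigr => i _.
      rewrite fineK// fin_num_measure//.
      rewrite -[X in measurable X]setTI.
      by apply: (measurable_funM (f := fun _ => a)).
    + by move=> i; exact: measurable_funM.
    + by move=> i x; rewrite mulr_ge0.
    + move=> i; rewrite (gaussian_scale_density (gaussX i) c1 (mB i)) fineK//.
      rewrite fin_num_measure// -[X in measurable X]setTI.
      by apply: (measurable_funM (f := fun _ => a)).
  transitivity (\int[P]_w (\prod_i (\1_(B i) (a * X i w) : R))%:E)%E.
    have /= -> := expectation_prod_indic indepX
      (B := fun i => *%R a @^-1` B i) => //.
    by move=> i; rewrite -[X in measurable X]setTI; exact: measurable_funM.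
  rewrite [RHS]integral_mkcond; apply: eq_integral => w _.
  rewrite (prodE (fun i w => a * X i w)) indicE /patch /=.
  by case: ifPn.
- move=> _; rewrite /nu2 /= /weighted_image preimage_setT integral_cst//=.
  by rewrite mul1e probability_setT ltry.
Qed.

End gaussian_tilt.

(** Each factor contributes [(1 + c) / sqrt (1 + 2 c)], which exceeds 1 only by
    a term of order [c^2]: with [c = 1/n] and of order [n^2] factors the second
    moment stays bounded. *)
Lemma gaussian_tilt_sqr (R : realType) (d : measure_display)
    (T : measurableType d) (P : probability T R) (I : finType)
    (X : I -> {RV P >-> R}) (c : R) : iid_standard_gaussian X -> 0 <= c ->
  (\int[P]_w ((\prod_i (Num.sqrt (1 + c) *
     expR (- (c * X i w ^+ 2 / 2)))) ^+ 2)%:E <=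
   (expR (c ^+ 2 / 2 * #|I|%:R))%:E)%E.
Proof.
move=> [indepX gaussX] c0; pose q : R := Num.sqrt (1 + 2 * c).
have q0 : 0 < q by rewrite sqrtr_gt0; lra.
have sqrE w :
    (\prod_i (Num.sqrt (1 + c) * expR (- (c * X i w ^+ 2 / 2)))) ^+ 2 =
    \prod_i ((1 + c) * expR (- (2 * c * X i w ^+ 2 / 2))).
  rewrite -prodrXl; apply: eq_bigr => i _.
  rewrite exprMn sqr_sqrtr; last by lra.
  by rewrite -expRM_natl; congr (_ * expR _); ring.
under eq_integral do rewrite sqrE.
rewrite (expectation_prod_independent indepX
  (F := fun i x => (1 + c) * expR (- (2 * c * x ^+ 2 / 2)))
  (m := fun i => (1 + c) * q^-1)).
- rewrite lee_fin prodr_const expRM_natr; apply: lerXn2r.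
  + by rewrite nnegrE mulr_ge0 ?invr_ge0 ?ltW//; lra.
  + by rewrite nnegrE expR_ge0.
  rewrite ler_pdivrMr//; have e0 := expR_ge0 (c ^+ 2 / 2).
  rewrite -(@ler_pXn2r _ 2) ?nnegrE ?mulr_ge0 ?(ltW q0)//; last by lra.
  rewrite exprMn [q ^+ 2]sqr_sqrtr; last by lra.
  rewrite -expRM_natl (_ : 2%:R * _ = c ^+ 2); last by field.
  have h := expR_ge1Dx (c ^+ 2).
  apply: (@le_trans _ _ ((1 + c ^+ 2) * (1 + 2 * c))); first by nra.
  by rewrite ler_wpM2r//; lra.
- by move=> i; apply: measurable_funM => //; exact: measurable_gauss_sqr.
- by move=> i x; rewrite mulr_ge0 ?expR_ge0//; lra.
- move=> i; under eq_integral do rewrite EFinM.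
  rewrite ge0_integralZl ?lee_fin//; last by lra.
  + by rewrite expectation_gaussian_expsqr//; lra.
  + apply/measurable_EFinP.
    exact: (measurableT_comp (measurable_gauss_sqr (2 * c))).
Qed.

(** * Second moment inequalities *)

Lemma measurable_superlevel (R : realType) (d : measure_display)
    (T : measurableType d) (f : T -> R) (c : R) :
  measurable_fun setT f -> measurable [set w | c <= f w].
Proof.
move=> mf; rewrite (_ : [set w | _] = f @^-1` `[c, +oo[%classic).
  by rewrite -[_ @^-1` _]setTI; exact: mf.
by apply/seteqP; split => w /=; rewrite in_itv/= andbT.
Qed.

Section second_moment.
Context (R : realType) (d : measure_display) (T : measurableType d)
  (P : probability T R) (Y : T -> R).
Hypotheses (mY : measurable_fun setT Y) (Y0 : forall w, 0 <= Y w).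

Let mY2 : measurable_fun setT (fun w => Y w ^+ 2).
Proof. exact: measurable_funX. Qed.

(** Cauchy-Schwarz with the optimisation over [t] left to the user; pointwise it
    is [2 t Y <= Y^2 + t^2]. *)
Lemma integral_event_le (A : set T) (t : R) : measurable A -> 0 < t ->
  (\int[P]_(w in A) (Y w)%:E <=
   (2 * t)^-1%:E * \int[P]_w (Y w ^+ 2)%:E + (t / 2)%:E * P A)%E.
Proof.
move=> mA t0.
have -> : ((t / 2)%:E * P A = \int[P]_(w in A) (t / 2)%:E)%E.
  by rewrite integral_cst.
have mEY2 : measurable_fun setT (fun w => (Y w ^+ 2)%:E).
  exact/measurable_EFinP.
have t2 : 0 <= (2 * t)^-1 by rewrite invr_ge0 mulr_ge0// ltW.
apply: (@le_trans _ _ ((2 * t)^-1%:E * \int[P]_(w in A) (Y w ^+ 2)%:E +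
    \int[P]_(w in A) (t / 2)%:E)%E); last first.
  apply: leeD2r; apply: lee_wpmul2l; first by rewrite lee_fin.
  by apply: ge0_subset_integral => // w _; rewrite lee_fin sqr_ge0.
rewrite -ge0_integralZl//; last 2 first.
- exact: measurable_funTS.
- by move=> w _; rewrite lee_fin sqr_ge0.
rewrite -ge0_integralD//; last 3 first.
- by move=> w _; rewrite mule_ge0// lee_fin sqr_ge0.
- by apply: measurable_funTS; exact: measurable_funeM.
- by move=> w _; rewrite lee_fin divr_ge0// ltW.
apply: ge0_le_integral => //.
- by move=> w _; rewrite lee_fin.
- by apply: measurable_funTS; exact/measurable_EFinP.
- apply/measurable_funTS/emeasurable_funD => //; exact: measurable_funeM.
move=> w _; rewrite -EFinM -EFinD lee_fin.
rewrite -subr_ge0 (_ : _ - _ = (2 * t)^-1 * (Y w - t) ^+ 2).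
  by rewrite mulr_ge0// sqr_ge0.
by field; rewrite gt_eqF.
Qed.

(** The part of [Y] below half its mean accounts for at most half of the mean;
    the rest is bounded by [integral_event_le]. *)
Lemma paley_zygmund (m C : R) : 0 < m -> 0 < C ->
    (\int[P]_w (Y w)%:E = m%:E)%E ->
    (\int[P]_w (Y w ^+ 2)%:E <= (C * m ^+ 2)%:E)%E ->
  ((4 * C)^-1%:E <= P [set w | (m / 2 <= Y w)%R])%E.
Proof.
move=> m0 C0 EY EY2; set A := [set w | _].
have mA : measurable A by exact: measurable_superlevel.
have mEY : measurable_fun setT (fun w => (Y w)%:E) by exact/measurable_EFinP.
have lowE : (\int[P]_(w in ~` A) (Y w)%:E <= (m / 2)%:E)%E.
  apply: (@le_trans _ _ (\int[P]_(w in ~` A) (m / 2)%:E)%E).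
    apply: ge0_le_integral => //.
    - exact: measurableC.
    - by move=> w _; rewrite lee_fin.
    - exact: measurable_funTS.
    - by move=> w /= /negP; rewrite -ltNge => /ltW; rewrite lee_fin.
  rewrite integral_cst; last exact: measurableC.
  rewrite -[leRHS]mule1; apply: lee_wpmul2l.
    by rewrite lee_fin divr_ge0 ?ltW.
  by apply: probability_le1; exact: measurableC.
(* With [t = 2 C m] the second moment costs only a quarter of the mean. *)
have t0 : 0 < 2 * C * m by rewrite !mulr_gt0.
have highE := integral_event_le mA t0.
have Pfin : P A = (fine (P A))%:E by rewrite fineK// fin_num_measure.
have : (m%:E <= (m / 2)%:E + ((2 * (2 * C * m))^-1%:E * (C * m ^+ 2)%:E +
    (2 * C * m / 2)%:E * P A))%E.
  rewrite -[leLHS]EY -(setUv A) ge0_integral_setU//; last 4 first.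
  - exact: measurableC.
  - by rewrite setUv.
  - by move=> w _; rewrite lee_fin.
  - by rewrite /disj_set; apply/eqP; rewrite setICr.
  rewrite addeC; apply: leeD => //; apply: (le_trans highE).
  apply: leeD2r; apply: lee_wpmul2l => //.
  by rewrite lee_fin invr_ge0 mulr_ge0// ltW.
rewrite Pfin -!EFinM -!EFinD !lee_fin.
have -> : (2 * (2 * C * m))^-1 * (C * m ^+ 2) = m / 4 by field; rewrite !gt_eqF.
have -> : 2 * C * m / 2 = m * C by field.
move=> h; rewrite -div1r ler_pdivrMr ?mulr_gt0//.
have : m * (1 / 4) <= m * (C * fine (P A)) by lra.
by rewrite ler_pM2l// => ?; lra.
Qed.

End second_moment.

(** * Sums over edges and the maximal energy *)

Section quadratic_sums.
Context {R : realType} {n : nat}.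

Lemma sum_edge (F : 'I_n * 'I_n -> R) :
  \sum_(e : edge n) F (val e) = \sum_(p : 'I_n * 'I_n | (p.1 < p.2)%N) F p.
Proof.
apply/esym; exact: (big_sub [pred p : 'I_n * 'I_n | (p.1 < p.2)%N] F).
Qed.

Lemma sum_edge_mul (x : 'I_n -> R) :
  2 * \sum_(e : edge n) x (val e).1 * x (val e).2 =
  (\sum_i x i) ^+ 2 - \sum_i x i ^+ 2.
Proof.
rewrite (sum_edge (fun p => x p.1 * x p.2)) expr2 big_distrlr/= pair_big/=.
rewrite [in RHS](bigID (fun p : 'I_n * 'I_n => (p.1 < p.2)%N))/=.
rewrite [X in _ = _ + X - _](bigID (fun p : 'I_n * 'I_n => (p.2 < p.1)%N))/=.
rewrite [X in _ = _ + (X + _) - _](_ : _ =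
    \sum_(p : 'I_n * 'I_n | (p.1 < p.2)%N) x p.1 * x p.2); last first.
  rewrite (reindex_inj (h := fun p : 'I_n * 'I_n => (p.2, p.1)))/=; last first.
    by move=> [a b] [a' b'] [-> ->].
  by apply: eq_big => [p|p _]; [case: ltngtP|rewrite mulrC].
rewrite [X in _ = _ + (_ + X) - _](_ : _ = \sum_i x i ^+ 2); last first.
  rewrite (reindex_omap (fun i : 'I_n => (i, i))
    (fun p : 'I_n * 'I_n => if p.1 == p.2 then Some p.1 else None))/=.
    apply: eq_big => [i|i _]; last by rewrite expr2.
    by rewrite ltnn eqxx eqxx.
  move=> [a b] /=; rewrite -!leqNgt -eqn_leq => /eqP/val_inj ->.
  by rewrite eqxx.
ring.
Qed.

Lemma edge_count : 2 * #|edge n|%:R = (n%:R ^+ 2 - n%:R : R).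
Proof.
have := sum_edge_mul (fun _ => 1); rewrite mulr1 expr1n !sumr_const.
by rewrite card_ord => <-.
Qed.

Lemma sk_energy_le_max (g : edge n -> R) (s : {ffun 'I_n -> bool}) :
  sk_energy g s <= sk_max g.
Proof. exact: le_bigmax. Qed.

Lemma sk_max_scale (a : R) (g : edge n -> R) : 0 <= a ->
  sk_max (fun e => a * g e) = a * sk_max g.
Proof.
move=> a0; have energyE s : sk_energy (fun e => a * g e) s = a * sk_energy g s.
  rewrite /sk_energy mulrCA; congr (_ * _); rewrite mulr_sumr.
  by apply: eq_bigr => e _; rewrite !mulrA.
rewrite /sk_max; elim: (index_enum _) => [|s r IH]; first by rewrite !big_nil.
by rewrite !big_cons IH energyE maxr_pMr.
Qed.

Lemma measurable_sk_max (d : measure_display) (T : measurableType d)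
    (g : edge n -> T -> R) : (forall e, measurable_fun setT (g e)) ->
  measurable_fun setT (fun w => sk_max (g ^~ w)).
Proof.
move=> mg; have mE s : measurable_fun setT (fun w => sk_energy (g ^~ w) s).
  apply: measurable_funM => //; apply: measurable_sum => e.
  by apply: measurable_funM => //; exact: measurable_funM.
rewrite /sk_max; elim: (index_enum _) => [|s r IH].
  under eq_fun do rewrite big_nil; exact: mE.
under eq_fun do rewrite big_cons; exact: measurable_maxr (mE s) IH.
Qed.

End quadratic_sums.

(** * Exponential square moment of a sum of signs *)

Section rademacher.
Context {R : realType}.
Local Notation mu := (@lebesgue_measure R).
Local Notation phi := (@normal_pdf R 0 1).

Lemma expR_le_quadratic (x : R) : `|x| <= 1 / 2 ->
  expR x <= 1 + x + 2 * x ^+ 2.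
Proof.
rewrite ler_norml => /andP[x1 x2].
have h := expR_ge1Dx (- x / 2).
have : expR x * expR (- x / 2) ^+ 2 = 1.
  by rewrite -expRM_natl -expRD (_ : _ + _ = 0) ?expR0//; field.
have h2 : (1 + - x / 2) ^+ 2 <= expR (- x / 2) ^+ 2.
  by apply: lerXn2r => //; rewrite nnegrE ?expR_ge0//; lra.
have p := expR_gt0 x; have p2 : 0 < (1 + - x / 2) ^+ 2 by apply: exprn_gt0; lra.
move=> e1; rewrite -(ler_pM2r p2).
apply: (@le_trans _ _ 1); first by rewrite -[leRHS]e1 ler_pM2l.
nra.
Qed.

(** The constant is not the optimal [1/2]; with this one, a quadratic bound of
    the exponential near 0 and [`|x| <= 2 x^2] away from 0 are enough. *)
Lemma cosh_le_gauss (x : R) : expR x + expR (- x) <= 2 * expR (2 * x ^+ 2).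
Proof.
have [xs|xl] := leP `|x| (1 / 2).
  have := expR_le_quadratic xs; have := expR_le_quadratic (x := - x).
  rewrite normrN => /(_ xs); have := expR_ge1Dx (2 * x ^+ 2).
  by rewrite sqrrN; lra.
suff h y : `|y| = `|x| -> expR y <= expR (2 * x ^+ 2).
  by rewrite (_ : 2 * expR _ = expR (2 * x ^+ 2) + expR (2 * x ^+ 2)); [
    rewrite lerD// h// normrN | ring].
move=> yx; rewrite ler_expR (le_trans (ler_norm _))// yx.
by rewrite -real_normK ?num_real//; nra.
Qed.

(** The square in the exponent is linearised by an auxiliary standard Gaussian
    [z], since [exp (l^2 / 2)] is the mean of [exp (l z)]. The sum over
    configurations then factors into [(2 cosh (k z))^n], and [cosh_le_gauss]
    leaves a Gaussian integral in [z]. *)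
Lemma rademacher_sqr_exp_moment (n : nat) (k : R) : 4 * k ^+ 2 * n%:R < 1 ->
  \sum_(s : {ffun 'I_n -> bool}) expR (k ^+ 2 * (\sum_i spin R s i) ^+ 2 / 2)
  <= 2 ^+ n * (Num.sqrt (1 - 4 * k ^+ 2 * n%:R))^-1.
Proof.
move=> k1; rewrite -lee_fin -sumEFin EFinM.
have mphi : measurable_fun setT phi by exact: measurable_normal_pdf.
have phi0 x : 0 <= phi x by exact: normal_pdf_ge0.
have mexp l : measurable_fun setT (fun z : R => expR (l * z)).
  by apply: measurableT_comp => //; exact: measurable_funM.
have -> : (\sum_(s : {ffun 'I_n -> bool})
    (expR (k ^+ 2 * (\sum_i spin R s i) ^+ 2 / 2))%:E =
    \int[mu]_z ((expR (k * z) + expR (- k * z)) ^+ n * phi z)%:E)%E.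
  transitivity (\sum_(s : {ffun 'I_n -> bool})
      \int[mu]_z (expR ((k * \sum_i spin R s i) * z) * phi z)%:E)%E.
    by apply: eq_bigr => s _; rewrite integral_exp_normal_pdf exprMn.
  rewrite -ge0_integral_sum//; last 2 first.
  - by move=> s; apply/measurable_EFinP/measurable_funM; first exact: mexp.
  - by move=> s z _; rewrite lee_fin mulr_ge0 ?expR_ge0.
  apply: eq_integral => z _; rewrite sumEFin; congr (_%:E).
  rewrite -mulr_suml; congr (_ * _).
  transitivity (\prod_(i < n) \sum_(b : bool) expR ((-1) ^+ b * (k * z))).
    rewrite bigA_distr_bigA/=; apply: eq_bigr => s _.
    rewrite -expR_sum; congr expR; rewrite -mulr_suml /spin.
    by rewrite [k * _]mulrC mulrA.
  rewrite prodr_const card_ord big_bool/= expr1 expr0 mul1r mulN1r addrC.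
  by rewrite mulNr.
rewrite -[(Num.sqrt _)^-1%:E]integral_expsqr_normal_pdf; last by lra.
rewrite -ge0_integralZl ?lee_fin ?exprn_ge0//; last 2 first.
- by apply/measurable_EFinP/measurable_funM; first exact: measurable_gauss_sqr.
- by move=> z _; rewrite lee_fin mulr_ge0 ?expR_ge0.
apply: ge0_le_integral => //.
- by move=> z _; rewrite lee_fin mulr_ge0 ?exprn_ge0 ?addr_ge0 ?expR_ge0.
- apply/measurable_EFinP/measurable_funM; last exact: mphi.
  apply: measurable_funX; apply: measurable_funD; exact: mexp.
- apply/measurable_EFinP/measurable_funM; first exact: measurable_cst.
  by apply: measurable_funM; [exact: measurable_gauss_sqr|exact: mphi].
move=> z _; rewrite -EFinM lee_fin mulrA ler_wpM2r//.
apply: (@le_trans _ _ ((2 * expR (2 * (k * z) ^+ 2)) ^+ n)).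
  rewrite lerXn2r ?nnegrE ?addr_ge0 ?mulr_ge0 ?expR_ge0//.
  by rewrite mulNr cosh_le_gauss.
rewrite exprMn -expRM_natl.
rewrite (_ : n%:R * _ = - (- (4 * k ^+ 2 * n%:R) * z ^+ 2 / 2))//.
by field.
Qed.

End rademacher.

(** * The partition function at high temperature *)

Section partition_function.
Context {R : realType}.

Lemma expectation_exp_linear (d : measure_display) (T : measurableType d)
    (P : probability T R) (I : finType) (X : I -> {RV P >-> R}) (l : I -> R) :
    iid_standard_gaussian X ->
  (\int[P]_w (expR (\sum_i l i * X i w))%:E =
   (expR ((\sum_i l i ^+ 2) / 2))%:E)%E.
Proof.
move=> [indepX gaussX].
under eq_integral do rewrite expR_sum.
rewrite (expectation_prod_independent indepX (F := fun i x => expR (l i * x))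
  (m := fun i => expR (l i ^+ 2 / 2))).
- by rewrite -expR_sum mulr_suml.
- by move=> i; apply: measurableT_comp => //; exact: measurable_funM.
- by move=> i x; exact: expR_ge0.
- by move=> i; exact: expectation_gaussian_exp.
Qed.

Context {n : nat}.

Definition coupling (s : {ffun 'I_n -> bool}) (e : edge n) : R :=
  spin R s (val e).1 * spin R s (val e).2.

Lemma coupling_sqr s e : coupling s e ^+ 2 = 1.
Proof. by rewrite /coupling /spin exprMn !sqrr_sign mulr1. Qed.

Definition spin_xor (s t : {ffun 'I_n -> bool}) : {ffun 'I_n -> bool} :=
  [ffun i => s i (+) t i].

(** Makes the relative configuration of two replicas the only variable of the
    second moment. *)
Lemma coupling_xor s t e :
  coupling (spin_xor s t) e = coupling s e * coupling t e.
Proof. by rewrite /coupling /spin !ffunE !signr_addb mulrACA. Qed.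

Lemma spin_xorK s : involutive (spin_xor s).
Proof. by move=> t; apply/ffunP => i; rewrite !ffunE addKb. Qed.

Lemma sum_coupling (s : {ffun 'I_n -> bool}) :
  \sum_e coupling s e <= (\sum_i spin R s i) ^+ 2 / 2.
Proof.
have := sum_edge_mul (spin R s).
have : 0 <= \sum_i spin R s i ^+ 2 by apply: sumr_ge0 => i _; exact: sqr_ge0.
rewrite -[\sum_(e : edge n) _]/(\sum_e coupling s e); lra.
Qed.

Context (d : measure_display) (T : measurableType d)
  (P : probability T R) (g : edge n -> {RV P >-> R}) (k : R).
Hypothesis iidg : iid_standard_gaussian g.

Definition partition_function (w : T) : R :=
  \sum_(s : {ffun 'I_n -> bool}) expR (\sum_e (k * coupling s e) * g e w).

Let mlin (l : edge n -> R) :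
  measurable_fun setT (fun w => expR (\sum_e l e * g e w)).
Proof.
apply: measurableT_comp => //; apply: measurable_sum => e.
exact: measurable_funM.
Qed.

Lemma measurable_partition_function : measurable_fun setT partition_function.
Proof. by apply: measurable_sum => s; exact: mlin. Qed.

Lemma partition_function_ge0 w : 0 <= partition_function w.
Proof. by apply: sumr_ge0 => s _; exact: expR_ge0. Qed.

Let mean := 2 ^+ n * expR (k ^+ 2 * #|edge n|%:R / 2).

Lemma partition_function_mean :
  (\int[P]_w (partition_function w)%:E = mean%:E)%E.
Proof.
under eq_integral do rewrite -sumEFin.
rewrite ge0_integral_sum//; last first.
  by move=> s; exact/measurable_EFinP.
under eq_bigr do rewrite expectation_exp_linear//.
rewrite sumEFin; congr (_%:E).
rewrite (eq_bigr (fun _ => expR (k ^+ 2 * #|edge n|%:R / 2))); last first.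
  move=> s _; congr (expR (_ / 2)).
  under eq_bigr do rewrite exprMn coupling_sqr mulr1.
  by rewrite sumr_const mulr_natr.
by rewrite sumr_const card_ffun card_bool card_ord -[LHS]mulr_natl natrX.
Qed.

(** For a pair of configurations the Gaussian expectation depends only on their
    [spin_xor], so one of the two sums is free, and what remains is the
    exponential of half the squared overlap. *)
Lemma partition_function_sqr : 4 * k ^+ 2 * n%:R < 1 ->
  (\int[P]_w (partition_function w ^+ 2)%:E <=
   ((Num.sqrt (1 - 4 * k ^+ 2 * n%:R))^-1 * mean ^+ 2)%:E)%E.
Proof.
move=> k1.
pose F (s t : {ffun 'I_n -> bool}) (e : edge n) :=
  k * coupling s e + k * coupling t e.
have sqrE w : (partition_function w ^+ 2)%:E =
    (\sum_s \sum_t (expR (\sum_e F s t e * g e w))%:E)%E.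
  rewrite expr2 big_distrlr/= -sumEFin; apply: eq_bigr => s _.
  rewrite -sumEFin; apply: eq_bigr => t _; congr (_%:E).
  rewrite -expRD -big_split; congr expR.
  by apply: eq_bigr => e _; rewrite mulrDl.
under eq_integral do rewrite sqrE.
rewrite ge0_integral_sum//; last 2 first.
- by move=> s; apply: emeasurable_sum => t; exact/measurable_EFinP.
- by move=> s w _; apply: sume_ge0 => t _; rewrite lee_fin expR_ge0.
under eq_bigr => s _.
  rewrite ge0_integral_sum//; last first.
    by move=> t; exact/measurable_EFinP.
  under eq_bigr do rewrite expectation_exp_linear//.
  rewrite sumEFin; over.
rewrite sumEFin lee_fin.
have FE s t : expR ((\sum_e F s t e ^+ 2) / 2) =
    expR (k ^+ 2 * #|edge n|%:R) *
    expR (k ^+ 2 * \sum_e coupling (spin_xor s t) e).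
  rewrite -expRD -mulrDr -sum1_card natr_sum -big_split/=; congr expR.
  rewrite mulr_sumr mulr_suml; apply: eq_bigr => e _.
  rewrite coupling_xor /F -mulrDr exprMn sqrrD !coupling_sqr.
  by field.
under eq_bigr do under eq_bigr do rewrite FE.
under eq_bigr => s _.
  rewrite -mulr_sumr (reindex_inj (inv_inj (spin_xorK s)))/=.
  under eq_bigr do rewrite spin_xorK.
  over.
rewrite sumr_const card_ffun card_bool card_ord -[leLHS]mulr_natl natrX.
rewrite /mean exprMn -expRM_natl.
rewrite (_ : 2%:R * _ = k ^+ 2 * #|edge n|%:R); last by field.
set E := expR _.
rewrite (_ : _ * (_ * E) = 2 ^+ n * (E * (2 ^+ n *
  (Num.sqrt (1 - 4 * k ^+ 2 * n%:R))^-1))); last by ring.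
rewrite ler_wpM2l ?exprn_ge0// ler_wpM2l ?expR_ge0//.
apply: le_trans (rademacher_sqr_exp_moment k1).
apply: ler_sum => s _; rewrite ler_expR -mulrA ler_wpM2l ?sqr_ge0//.
exact: sum_coupling.
Qed.

(** The sum of [2^n] terms is at most [2^n] times the largest one. The loss of
    the factor 2 in [mean / 2] costs less than 4 after division by the inverse
    temperature, and [n >= 130] is what makes [(n - 1) / 16 - 4 >= n / 32]. *)
Lemma sk_max_ge (w : T) : (130 <= n)%N -> k = (4 * Num.sqrt n%:R)^-1 ->
  mean / 2 <= partition_function w -> n%:R / 32 <= sk_max (fun e => g e w).
Proof.
move=> n130 kE; set M := sk_max _.
have n0 : 130 <= n%:R :> R by rewrite (ler_nat _ 130).
have s0 : 0 < Num.sqrt (n%:R : R) by rewrite sqrtr_gt0; lra.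
have upper : partition_function w <= 2 ^+ n * expR (M / 4).
  rewrite (_ : 2 ^+ n * _ =
      \sum_(s : {ffun 'I_n -> bool}) expR (M / 4)); last first.
    by rewrite sumr_const card_ffun card_bool card_ord -[RHS]mulr_natl natrX.
  apply: ler_sum => s _; rewrite ler_expR.
  rewrite (_ : \sum_e _ = sk_energy (fun e => g e w) s / 4).
    by rewrite ler_wpM2r// ?invr_ge0// sk_energy_le_max.
  rewrite /sk_energy mulrAC mulr_sumr; apply: eq_bigr => e _.
  by rewrite kE /coupling invfM; ring.
move=> /le_trans/(_ upper); rewrite /mean -mulrA ler_pM2l ?exprn_gt0//.
have two : 2 <= expR 1 :> R by have := expR_ge1Dx (1 : R); lra.
have k2 : k ^+ 2 = (16 * n%:R)^-1.
  by rewrite kE exprVn exprMn sqr_sqrtr; [congr (_^-1); ring|lra].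
have -> : k ^+ 2 * #|edge n|%:R / 2 = (n%:R - 1) / 64.
  have := @edge_count R n; rewrite k2 => eN.
  have -> : #|edge n|%:R = (n%:R ^+ 2 - n%:R) / 2 :> R by lra.
  by field; lra.
rewrite ler_pdivrMr// => h.
have : expR ((n%:R - 1) / 64) <= expR (M / 4 + 1).
  by apply: (le_trans h); rewrite expRD ler_wpM2l ?expR_ge0.
by rewrite ler_expR; lra.
Qed.

End partition_function.

(** The choice [k = 1 / (4 sqrt n)] is inverse temperature 1/4. It makes
    [4 k^2 n = 1/4], so the ratio of the second moment to the squared mean is at
    most [1 / sqrt (3/4) <= 2]. *)
Lemma sk_max_lower_bound (R : realType) (n : nat) (d : measure_display)
    (T : measurableType d) (P : probability T R) (g : edge n -> {RV P >-> R}) :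
    (130 <= n)%N -> iid_standard_gaussian g ->
  (8^-1%:E <= P [set w | (n%:R / 32 <= sk_max (fun e => g e w))%R])%E.
Proof.
move=> n130 iidg; pose k : R := (4 * Num.sqrt n%:R)^-1.
have n0 : 130 <= n%:R :> R by rewrite (ler_nat _ 130).
have k2 : 4 * k ^+ 2 * n%:R = 4^-1.
  rewrite /k exprVn exprMn sqr_sqrtr; last by lra.
  by field; lra.
have k1 : 4 * k ^+ 2 * n%:R < 1 by rewrite k2; lra.
have sqrt2 : (Num.sqrt (1 - 4 * k ^+ 2 * n%:R))^-1 <= 2.
  rewrite k2 -[leRHS]invrK lef_pV2 ?posrE ?sqrtr_gt0//; last by lra.
  rewrite -[leLHS]ger0_norm// -sqrtr_sqr ler_wsqrtr//; lra.
have m0 : 0 < 2 ^+ n * expR (k ^+ 2 * #|edge n|%:R / 2).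
  by rewrite mulr_gt0 ?exprn_gt0 ?expR_gt0.
have := paley_zygmund (measurable_partition_function g k)
  (partition_function_ge0 g k) m0 (ltr0n R 2) (partition_function_mean k iidg).
rewrite (_ : 4 * 2 = 8 :> R); last by ring.
move=> /(_ _)/le_trans; apply.
  apply: (le_trans (partition_function_sqr iidg k1)).
  by rewrite lee_fin ler_wpM2r// sqr_ge0.
apply: le_measure; rewrite ?inE.
- exact/measurable_superlevel/measurable_partition_function.
- exact/measurable_superlevel/measurable_sk_max.
by move=> w /=; exact: sk_max_ge.
Qed.

(** * Spread of the ground state *)

(** With [A] the event that the interval contains [G], [A'] the event that it
    misses [s G] and [B] the event [G >= n/32]: [B] is contained in
    [~` A `|` A'], and [P A' <= 1/16 + 8 P (~` A)], whence
    [1/8 <= 1/16 + 9 P (~` A)]. *)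
Lemma ground_state_spread (R : realType) (n : nat) (d : measure_display)
    (T : measurableType d) (P : probability T R) (g : edge n -> {RV P >-> R})
    (a b : R) : (130 <= n)%N -> iid_standard_gaussian g -> b - a <= 256^-1 ->
  (P [set w | (a <= ground_state g w <= b)%R] <= (1 - 144^-1)%:E)%E.
Proof.
move=> n130 iidg ab; set A := [set w | _].
have n0 : 130 <= n%:R :> R by rewrite (ler_nat _ 130).
pose c : R := n%:R^-1.
have c0 : 0 < c by rewrite invr_gt0; lra.
have c1 : c <= 1 by rewrite invf_le1; lra.
have cn : c * n%:R = 1 by rewrite mulVf//; lra.
set s := (Num.sqrt (1 + c))^-1.
have s0 : 0 <= s by rewrite invr_ge0.
have sle : s <= 1 - c / 4.
  have s2 : s ^+ 2 * (1 + c) = 1.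
    by rewrite exprVn sqr_sqrtr; [rewrite mulVf//; lra|lra].
  rewrite -ler_sqr ?nnegrE//; last by lra.
  rewrite -(ler_pM2r (_ : 0 < 1 + c)); last by lra.
  by rewrite s2; nra.
pose D : set (g_sigma_algebraType (@rectangles R (edge n))) :=
  [set x | ~ (a <= sk_max (x : edge n -> R) <= b)].
have mD : measurable D.
  rewrite (_ : D = ~` (@sk_max R n @^-1` `[a, b]%classic)); last first.
    by apply/seteqP; split => x /=; rewrite in_itv.
  apply: measurableC; rewrite -[X in measurable X]setTI.
  exact: (measurable_sk_max (@measurable_coordinate R (edge n))).
have AE : ~` A = [set w | D (g ^~ w)] by [].
have mA : measurable (~` A).
  rewrite AE -[X in measurable X]setTI.
  by apply: (measurable_to_product (Y := fun e => g e)).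
pose A' := [set w | D (fun e => s * g e w)].
have mA' : measurable A'.
  rewrite /A' -[X in measurable X]setTI.
  apply: (measurable_to_product (Y := fun e w => s * g e w)) => //.
  by move=> e; exact: measurable_funM.
pose B := [set w | n%:R / 32 <= sk_max (fun e => g e w)].
have mB : measurable B by apply/measurable_superlevel/measurable_sk_max.
have BA : B `<=` ~` A `|` A'.
  move=> w Bw; apply: contrapT => /not_orP[/contrapT Aw].
  rewrite /A' /D /= => /contrapT; rewrite sk_max_scale//.
  move: Aw Bw; rewrite /A /B /ground_state /=; set G := sk_max _.
  move=> /andP[aG Gb] nG /andP[asG sGb].
  have : c / 4 * (n%:R / 32) <= (1 - s) * G.
    by apply: ler_pM => //; lra.
  by rewrite mulrACA cn mul1r; lra.
have PA' : (P A' <= (16^-1)%:E + 8%:E * P (~` A))%E.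
  rewrite /A' -(gaussian_tilt iidg _ mD); last by lra.
  rewrite -AE; apply: le_trans.
    (* [t = 16]: the first term is then at most 1/16, half of [P B]. *)
    apply: (@integral_event_le _ _ _ _ _ _ _ _ 16) => //.
    + by apply: measurable_prod => e _; apply: measurable_funM => //;
        exact: (measurableT_comp (measurable_gauss_sqr c)).
    + by move=> w; apply: prodr_ge0 => e _; rewrite mulr_ge0 ?expR_ge0.
  rewrite (_ : 16 / 2 = 8 :> R); last by field.
  apply: leeD2r; apply: (@le_trans _ _ ((2 * 16)^-1%:E * 2%:E)%E); last first.
    by rewrite -EFinM lee_fin; lra.
  apply: lee_wpmul2l; first by rewrite lee_fin; lra.
  apply: (le_trans (gaussian_tilt_sqr iidg (ltW c0))); rewrite lee_fin.
  have -> : c ^+ 2 / 2 * #|edge n|%:R = (1 - c) / 4.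
    have := @edge_count R n => eN.
    have -> : #|edge n|%:R = (n%:R ^+ 2 - n%:R) / 2 :> R by lra.
    by rewrite /c; field; lra.
  apply: (@le_trans _ _ (expR (1 / 4))); first by rewrite ler_expR; lra.
  apply: (le_trans (expR_le_quadratic _)); last by lra.
  by rewrite ger0_norm; lra.
have PB := sk_max_lower_bound n130 iidg.
have fA : P (~` A) = (fine (P (~` A)))%:E by rewrite fineK// fin_num_measure.
have : (8^-1%:E <= P (~` A) + (16^-1%:E + 8%:E * P (~` A)))%E.
  apply: (le_trans PB); apply: (@le_trans _ _ (P (~` A `|` A'))).
    by apply: le_measure; rewrite ?inE//; exact: measurableU.
  by apply: (le_trans (measureU2 _ _ _)) => //; exact: leeD2l.
rewrite fA -EFinM -!EFinD lee_fin => h.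
have mA0 : measurable A by rewrite -[A]setCK; exact: measurableC.
rewrite -[A]setCK probability_setC// fA -EFinB lee_fin; lra.
Qed.

Theorem theorem2p5 (R : realType) (d : nat -> measure_display)
    (T : forall n : nat, measurableType (d n))
    (P : forall n : nat, probability (T n) R)
    (g : forall n : nat, edge n -> {RV (P n) >-> R})
    (hg : forall n : nat, iid_standard_gaussian (g n)) :
  fluctuations_at_least (fun n => ground_state (g n) : {RV (P n) >-> R})
    (fun _ => 1).
Proof.
exists 256^-1, 144^-1; split; [by rewrite invr_gt0..|].
exists 130%N => // n n130 a b _; rewrite mulr1 => ab.
exact: ground_state_spread.
Qed.
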